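(* Let $p$ be an odd prime, let $\alpha,\beta$ be positive integers, and let $G = \mathbb{Z}_{p^{\alpha}}\oplus\mathbb{Z}_{p^\beta}$, with exponent $\exp(G)=p^{\max(\alpha,\beta)}$. Let $A=\{a\in\mathbb{N} : 1\le a\le p^{\max(\alpha,\beta)},\ \gcd(a,p)=1\}$. Then $s_{A}(G)= \eta_A(G) + \exp(G) - 1$.
   Context: $\mathbb{Z}_n$ denotes the cyclic group $\mathbb{Z}/n\mathbb{Z}$. A sequence over a finite abelian group $G$ (written additively) is a finite list of elements of $G$, repetitions allowed, order irrelevant; its length is its number of terms, and a subsequence is obtained by choosing a subset of the indices. For a set of integers $A$, a sequence $x_1\cdots x_k$ over $G$ ($k\ge 1$) is an $A$-weighted zero-sum sequence of length $k$ if there exist $u_1,\dots,u_k\in A$ (not necessarily distinct) with $u_1x_1+\cdots+u_kx_k=0$ in $G$. If $G$ has exponent $n$: $s_A(G)$ is the smallest integer $\ell$ such that every sequence over $G$ of length at least $\ell$ has an $A$-weighted zero-sum subsequence of length exactly $n$; $\eta_A(G)$ is the smallest integer $\ell$ such that every sequence over $G$ of length at least $\ell$ has a nonempty $A$-weighted zero-sum subsequence of length at most $n$. *)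

(* Defs.v *)
From HB Require Import structures.
From mathcomp Require Import all_boot all_order all_algebra all_fingroup.
From mathcomp Require Import all_solvable.
From mathcomp Require Import boolp classical_sets.

Set Implicit Arguments.
Unset Strict Implicit.
Unset Printing Implicit Defensive.

Import GRing.Theory.
Local Open Scope classical_set_scope.
Local Open Scope ring_scope.

HB.instance Definition _ (U V : finZmodType) := GRing.Zmodule.on (U * V)%type.

(* Through the coercion [finZmodType >-> finGroupType], the group law used by
   [exponent] is the addition of [G]. *)
Definition gexp (G : finZmodType) : nat := exponent [set: G]%SET.

(* Junk value 0 when no natural number satisfies [P]; see [smallestP]. *)
Definition smallest (P : nat -> Prop) : nat :=
  xget 0%N [set l | P l /\ forall m, P m -> (l <= m)%N].

Definition weighted_zero_sum (A : set int) (G : finZmodType) (t : seq G) : Prop :=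
  (0 < size t)%N /\
  exists u : 'I_(size t) -> int,
    (forall i, A (u i)) /\ \sum_(i < size t) t`_i *~ u i = 0.

Definition s_forces (A : set int) (G : finZmodType) (l : nat) : Prop :=
  forall s : seq G, (l <= size s)%N ->
    exists t : seq G,
      [/\ subseq t s, weighted_zero_sum A t & size t = gexp G].

Definition s_const (A : set int) (G : finZmodType) : nat :=
  smallest (@s_forces A G).

Definition eta_forces (A : set int) (G : finZmodType) (l : nat) : Prop :=
  forall s : seq G, (l <= size s)%N ->
    exists t : seq G,
      [/\ subseq t s, weighted_zero_sum A t & (size t <= gexp G)%N].

Definition eta_const (A : set int) (G : finZmodType) : nat :=
  smallest (@eta_forces A G).

Lemma smallestP (P : nat -> Prop) : (exists l, P l) ->
  P (smallest P) /\ forall m, P m -> (smallest P <= m)%N.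
Proof.
move=> [l Pl]; rewrite /smallest; case: xgetP => [y _ //|none].
have exP : exists n, `[< P n >] by exists l; apply/asboolP.
case: (ex_minnP exP) => m /asboolP Pm minm.
by case: (none m); split=> // k Pk; apply: minm; apply/asboolP.
Qed.

Lemma gexp_gt0 (G : finZmodType) : (0 < gexp G)%N.
Proof. exact: exponent_gt0. Qed.

Lemma mulrn_gexp (G : finZmodType) (x : G) : x *+ gexp G = 0.
Proof.
rewrite -[LHS]FinRing.zmodXgE; apply: expg_exponent; exact: finset.in_setT.
Qed.

Lemma s_forces_ex (A : set int) (G : finZmodType) :
  A !=set0 -> exists l, @s_forces A G l.
Proof.
move=> [a Aa]; exists (#|G| * gexp G).+1 => s les.
have [x ltx] : exists x : G, (gexp G <= count_mem x s)%N.
  apply: contrapT => /forallNP nox; move: les; apply/negP; rewrite -leqNgt.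
  rewrite -sum1_size (partition_big id xpredT) //=.
  rewrite -sum_nat_const; apply: leq_sum => x _.
  by rewrite sum1_count leqNgt; apply/negP => /ltnW /nox.
exists (nseq (gexp G) x); split; last by rewrite size_nseq.
- apply: (subseq_trans _ (filter_subseq (pred1 x) s)).
  have -> : [seq y <- s | pred1 x y] = nseq (count_mem x s) x.
    rewrite -size_filter; apply/all_pred1P; exact: filter_all.
  by rewrite -(subnK ltx) nseqD suffix_subseq.
- split; first by rewrite size_nseq gexp_gt0.
  exists (fun=> a); split=> //.
  rewrite (eq_bigr (fun=> x *~ a)) => [|i _]; last first.
    by rewrite nth_nseq -[X in (_ < X)%N](size_nseq (gexp G) x) ltn_ord.
  by rewrite sumr_const card_ord size_nseq mulrn_gexp.
Qed.

Lemma s_constP (A : set int) (G : finZmodType) : A !=set0 ->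
  @s_forces A G (s_const A G) /\
  forall m, @s_forces A G m -> (s_const A G <= m)%N.
Proof. by move=> /s_forces_ex-/(_ G) /smallestP. Qed.

Lemma eta_constP (A : set int) (G : finZmodType) : A !=set0 ->
  @eta_forces A G (eta_const A G) /\
  forall m, @eta_forces A G m -> (eta_const A G <= m)%N.
Proof.
move=> /s_forces_ex-/(_ G) [l sl]; apply: smallestP; exists l => s /sl.
by move=> [t [ts wt szt]]; exists t; split; rewrite ?szt.
Qed.

Lemma gexp_prod_Zp (p alpha beta : nat) :
  prime p -> (0 < alpha)%N -> (0 < beta)%N ->
  gexp ('Z_(p ^ alpha) * 'Z_(p ^ beta))%type = (p ^ maxn alpha beta)%N.
Proof.
move=> pp a0 b0.
have p1 c : (0 < c)%N -> (1 < p ^ c)%N.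
  by move=> c0; rewrite -{1}(exp1n c) ltn_exp2r // prime_gt1.
apply/eqP; rewrite eqn_dvd; apply/andP; split.
  apply/exponentP => x _; rewrite FinRing.zmodXgE.
  have Z0 c (y : 'Z_(p ^ c)) : (0 < c)%N -> (c <= maxn alpha beta)%N ->
      y *+ (p ^ maxn alpha beta) = 0.
    move=> c0 cm; rewrite -(subnK cm) expnD mulnC mulrnA.
    by rewrite -(mulr_natr y) pchar_Zp ?p1 // mulr0 mul0rn.
  case: x => y z; rewrite pairMnE !Z0 ?leq_maxl ?leq_maxr //.
pose P := ('Z_(p ^ alpha) * 'Z_(p ^ beta))%type.
have H (c : nat) : (0 < c)%N ->
   (1 : 'Z_(p ^ c)) *+ gexp P = 0 -> (p ^ c %| gexp P)%N.
  move=> c0 /(congr1 val) /=; rewrite val_Zp_nat ?p1 // => /eqP.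
  by rewrite /dvdn.
have := mulrn_gexp ((1, 1) : P); rewrite pairMnE => e11.
case: (leqP alpha beta) => _; apply: H => //.
  exact: (congr1 (fun x : P => x.2) e11).
exact: (congr1 (fun x : P => x.1) e11).
Qed.

(* Main.v *)
Require Import Defs.
From mathcomp Require Import all_boot all_order all_algebra.
From mathcomp Require Import classical_sets.
From mathcomp Require Import ring zify.

(** Let [n = exp G].  Appending [n - 1] zeros to a sequence without short
    weighted zero-sums gives [s_A >= eta_A + n - 1].  Since the elements
    [(p^i, 0)] and [(0, p^j)] admit no weighted zero-sum, [eta_A > alpha + beta],
    so it remains to find a weighted zero-sum of length [n] among any
    [n + alpha + beta] elements.

    For [m >= 4] we show by induction on [a + b] that [m + a + b] integer vectors
    contain [m] whose combination with coefficients prime to [p] vanishes modulo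
    [(p^a, p^b)].  Consider the vectors that are nonzero mod [p].  If two of them
    span the same line and two others lie off it, Cramer's rule together with a
    suitable choice of the remaining coefficients gives all [m] units.  If two span
    the same line and at most one vector lies off it, discard that vector: the
    others live in an index [p] sublattice, where [a + b] has dropped by one.  If
    at most two vectors are nonzero, discard them and divide by [p].  Otherwise
    three vectors are pairwise independent mod [p], and Cramer's rule applies
    again.  The case [n = 3] forces [p = 3] and [alpha = beta = 1] and is treated
    separately. *)

Import Order.TTheory GRing.Theory Num.Theory.

Local Open Scope classical_set_scope.
Local Open Scope nat_scope.

(** * Subsets of prescribed size and divisibility of combinations *)

Lemma exists_subset_card (I : finType) (A D : {set I}) (m : nat) :
  A \subset D -> #|A| <= m <= #|D| ->
  exists T : {set I}, [/\ A \subset T, T \subset D & #|T| = m].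
Proof.
move=> AD /andP[Am mD].
have /card_geqP[s [us szs sD]] : m - #|A| <= #|D :\: A|.
  by rewrite cardsD (finset.setIidPr AD) leq_sub2r.
exists (A :|: [set z in s]%SET); split; first exact: finset.subsetUl.
- rewrite finset.subUset AD; apply/fintype.subsetP => z; rewrite inE => /sD.
  by rewrite inE => /andP[].
- have As : A :&: [set z in s]%SET = finset.set0.
    apply/setP => z; rewrite !inE; case: (boolP (z \in s)) => [/sD|].
      by rewrite inE => /andP[/negPf ->].
    by rewrite andbF.
  by rewrite cardsU As cards0 subn0 cardsE (card_uniqP us) szs subnKC.
Qed.

Lemma dvdz_lincomb (k1 k2 : int) {d u v w : int} :
  (d %| u)%Z -> (d %| v)%Z -> w = (k1 * u + k2 * v)%R -> (d %| w)%Z.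
Proof. by move=> du dv ->; rewrite rpredD ?dvdz_mull. Qed.

Lemma dvdz_scale (k : int) {d u w : int} :
  (d %| u)%Z -> w = (k * u)%R -> (d %| w)%Z.
Proof. by move=> du ->; rewrite dvdz_mull. Qed.

(** * Units and inverses modulo powers of [p] *)

Section ResiduesModP.

Set Implicit Arguments.
Unset Strict Implicit.

Local Open Scope ring_scope.

Variable p : nat.
Hypothesis p_prime : prime p.

Lemma dvdz_primeM (a b : int) : (p %| a * b)%Z = (p %| a)%Z || (p %| b)%Z.
Proof. by rewrite !dvdzE abszM Euclid_dvdM. Qed.

Lemma inverse_mod_exp (N : nat) (d : int) : ~~ (p %| d)%Z ->
  exists2 e : int, ~~ (p %| e)%Z & (p%:Z ^+ N %| d * e - 1)%Z.
Proof.
move=> pd.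
(* The exponent [N.+1] keeps a factor [p] in the modulus even for [N = 0], which forces [e] to be
   prime to [p]. *)
have : coprimez (p%:Z ^+ N.+1) d by rewrite coprimez_pexpl //
  coprimezE prime_coprime.
case/coprimezP=> [[u e]] /= ue.
have Ed : d * e - 1 = - u * p%:Z ^+ N * p by rewrite -[1]ue exprSr; ring.
exists e; last by rewrite Ed -mulrA mulrCA dvdz_mulr.
apply/negP => pe; have : (p %| (1 : int))%Z.
  apply: (@dvdz_lincomb d (u * p%:Z ^+ N) p e p 1) => //.
  by rewrite -[1]ue exprSr; ring.
by rewrite dvdz1 /= => /eqP p1; move: (prime_gt1 p_prime); rewrite p1.
Qed.

Hypothesis p_odd : odd p.

Lemma not_dvdp1 : ~~ (p %| (1 : int))%Z.
Proof. by rewrite dvdz1 /=; apply/eqP => p1; move: (prime_gt1 p_prime); rewrite p1. Qed.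

Lemma not_dvdp2 : ~~ (p %| (2 : int))%Z.
Proof.
apply/negP => /(dvdn_leq (ltn0Sn 1)) p2; move: p_odd (prime_gt1 p_prime).
by case: p p2 => [|[|[|]]].
Qed.

(** * Choosing unit coefficients in weighted sums *)

Section WeightedSums.

Variable I : finType.
Implicit Types (T S D U : {set I}) (c e f g x y : I -> int) (i j k l z : I).

Definition units_on T c := forall i, i \in T -> ~~ (p %| c i)%Z.

Definition setv c i (v : int) z := if z == i then v else c z.

Lemma setvE c i v : setv c i v i = v.
Proof. by rewrite /setv eqxx. Qed.

Lemma setv_out c i v z : z != i -> setv c i v z = c z.
Proof. by rewrite /setv => /negPf ->. Qed.

Lemma sum_setv_out S c i v f : i \notin S ->
  \sum_(z in S) setv c i v z * f z = \sum_(z in S) c z * f z.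
Proof.
move=> iS; apply: eq_bigr => z zS; rewrite setv_out //.
by apply: contraNneq iS => <-.
Qed.

Lemma sum_setv S c i v f : i \in S ->
  \sum_(z in S) setv c i v z * f z = v * f i + \sum_(z in S :\ i) c z * f z.
Proof. by move=> iS; rewrite (big_setD1 i) //= setvE sum_setv_out // !inE eqxx. Qed.

Lemma units_setv S c i v :
  units_on (S :\ i) c -> ~~ (p %| v)%Z -> units_on S (setv c i v).
Proof.
move=> uc pv z zS; rewrite /setv; case: eqVneq => // zi.
by apply: uc; rewrite !inE zi.
Qed.

(** The coefficients [1] and [-1] at [l] give sums that differ by [2 * f l], which is prime to [p]
    because [p] is odd; hence [p] divides at most one of them. *)
Lemma sum_avoid S l f c : l \in S -> ~~ (p %| f l)%Z -> units_on (S :\ l) c ->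
  exists v, units_on S (setv c l v) /\ ~~ (p %| \sum_(z in S) setv c l v z * f z)%Z.
Proof.
move=> lS pf uc; set R := \sum_(z in S :\ l) c z * f z.
have [p1|p1] := boolP (p %| 1 * f l + R)%Z; last first.
  exists 1; split; first exact: units_setv not_dvdp1.
  by rewrite sum_setv.
exists (-1); split; first by apply: units_setv; rewrite // rpredN not_dvdp1.
rewrite sum_setv // -/R; apply/negP => p2.
have : (p %| 2 * f l)%Z by apply: (dvdz_lincomb 1 (-1) p1 p2); ring.
by rewrite dvdz_primeM (negPf pf) (negPf not_dvdp2).
Qed.

(** Each of the two sums excludes at most one residue for the coefficient at [l]. As [p > 4], the
    values 1, 2, 3 are nonzero and distinct modulo [p], so one of them survives. *)
Lemma sum_avoid2 S l f g c : (4 < p)%N -> l \in S ->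
  ~~ (p %| f l)%Z -> ~~ (p %| g l)%Z -> units_on (S :\ l) c ->
  exists v, [/\ units_on S (setv c l v),
    ~~ (p %| \sum_(z in S) setv c l v z * f z)%Z &
    ~~ (p %| \sum_(z in S) setv c l v z * g z)%Z].
Proof.
move=> p4 lS pf pg uc.
set R := \sum_(z in S :\ l) c z * f z; set Q := \sum_(z in S :\ l) c z * g z.
have small (k : nat) : (0 < k < 4)%N -> ~~ (p %| (k : int))%Z.
  move=> /andP[k0 k4]; apply/negP => /(dvdn_leq k0) pk; lia.
have uniq2 h X (v w : int) : ~~ (p %| h l)%Z -> ~~ (p %| v - w)%Z ->
    (p %| v * h l + X)%Z -> (p %| w * h l + X)%Z -> False.
  move=> ph pvw pv pw.
  have : (p %| (v - w) * h l)%Z.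
    by apply: (dvdz_lincomb 1 (-1) pv pw); ring.
  by rewrite dvdz_primeM (negPf ph) (negPf pvw).
suff [v [pv vf vg]] : exists v : int,
    [/\ ~~ (p %| v)%Z, ~~ (p %| v * f l + R)%Z & ~~ (p %| v * g l + Q)%Z].
  by exists v; split; [exact: units_setv|rewrite sum_setv|rewrite sum_setv].
have [s1 s2 s3] : [/\ ~~ (p %| (1 : int))%Z, ~~ (p %| (2 : int))%Z & ~~ (p %| (3 : int))%Z].
  by split; apply: small.
have [a1|a1] := boolP (p %| 1 * f l + R)%Z; have [b1|b1] := boolP (p %| 1 * g l + Q)%Z.
- exists 2; split=> //; apply/negP => h; [exact: (uniq2 f R 2 1)|exact: (uniq2 g Q 2 1)].
- have [b2|b2] := boolP (p %| 2 * g l + Q)%Z.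
    exists 3; split=> //; apply/negP => h; [exact: (uniq2 f R 3 1)|exact: (uniq2 g Q 3 2)].
  by exists 2; split=> //; apply/negP => h; exact: (uniq2 f R 2 1).
- have [a2|a2] := boolP (p %| 2 * f l + R)%Z.
    exists 3; split=> //; apply/negP => h; [exact: (uniq2 f R 3 2)|exact: (uniq2 g Q 3 1)].
  by exists 2; split=> //; apply/negP => h; exact: (uniq2 g Q 2 1).
- by exists 1.
Qed.

(** The coefficient at [j] is adjusted until the sum over [T :\ i] is a unit; the coefficient at [i]
    that cancels this sum is then a unit as well. *)
Lemma units_sum_rank1 T f i j (N : nat) : i \in T -> j \in T -> i != j ->
  ~~ (p %| f i)%Z -> ~~ (p %| f j)%Z ->
  exists2 c, units_on T c & (p%:Z ^+ N %| \sum_(z in T) c z * f z)%Z.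
Proof.
move=> iT jT ij pi pj.
have [||v [uv pv]] := @sum_avoid (T :\ i) j f (fun=> 1) _ pj.
- by rewrite !inE eq_sym ij.
- by move=> *; exact: not_dvdp1.
have [e pe He] := inverse_mod_exp N pi.
set c := setv _ _ _ in uv pv; set R := \sum_(_ in _) _ in pv.
exists (setv c i (- (e * R))).
  by apply: units_setv => //; rewrite rpredN dvdz_primeM negb_or pe.
rewrite sum_setv // -/R; apply: (dvdz_scale (- R) He); ring.
Qed.

Definition det x y i j : int := x i * y j - x j * y i.

(* Cramer's rule: the coefficients at [i] and [k] are solved for, and the last
   two hypotheses say precisely that the solutions are units. *)
Lemma units_sum_cramer T x y i k e (N : nat) : i \in T -> k \in T -> i != k ->
  ~~ (p %| det x y i k)%Z -> units_on (T :\ i :\ k) e ->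
  ~~ (p %| \sum_(z in T :\ i :\ k) e z * det x y i z)%Z ->
  ~~ (p %| \sum_(z in T :\ i :\ k) e z * det x y k z)%Z ->
  exists c, [/\ units_on T c, (p%:Z ^+ N %| \sum_(z in T) c z * x z)%Z &
    (p%:Z ^+ N %| \sum_(z in T) c z * y z)%Z].
Proof.
move=> iT kT ik pd ue pi pk.
have kTi : k \in T :\ i by rewrite !inE eq_sym ik.
have [d pd' Hd] := inverse_mod_exp N pd.
set R := \sum_(z in T :\ i :\ k) e z * x z.
set Q := \sum_(z in T :\ i :\ k) e z * y z.
have Edet s : \sum_(z in T :\ i :\ k) e z * det x y s z = x s * Q - y s * R.
  rewrite /R /Q !mulr_sumr -sumrB; apply: eq_bigr => z _; rewrite /det; ring.
rewrite !{}Edet in pi pk.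
exists (setv (setv e k (- (d * (x i * Q - y i * R)))) i (d * (x k * Q - y k * R))).
have unitM r : ~~ (p %| r)%Z -> ~~ (p %| d * r)%Z.
  by move=> pr; rewrite dvdz_primeM negb_or pd'.
split.
- by do 2?apply: units_setv; rewrite ?rpredN ?unitM.
- rewrite !sum_setv // -/R; apply: (dvdz_scale (- R) Hd).
  rewrite /det; ring.
- rewrite !sum_setv // -/Q; apply: (dvdz_scale (- Q) Hd).
  rewrite /det; ring.
Qed.


(** * Zero-sums with unit coefficients, and division by [p] *)

Definition unit_zero_sum (m a b : nat) x y D := exists T c,
  [/\ T \subset D, #|T| = m, units_on T c,
     (p%:Z ^+ a %| \sum_(z in T) c z * x z)%Z &
     (p%:Z ^+ b %| \sum_(z in T) c z * y z)%Z].

Lemma unit_zero_sum_sub m a b x y D' D : D' \subset D ->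
  unit_zero_sum m a b x y D' -> unit_zero_sum m a b x y D.
Proof.
by move=> D'D [T [c [TD' ? ? ? ?]]]; exists T, c; rewrite (fintype.subset_trans TD').
Qed.

Lemma unit_zero_sumC m a b x y D :
  unit_zero_sum m a b x y D -> unit_zero_sum m b a y x D.
Proof. by move=> [T [c [? ? ? ? ?]]]; exists T, c. Qed.

(** The shear [x - l * y] moves the line [x = l * y] modulo [p] onto [x = 0], after which the first
    coordinate is divided by [p]. Undoing the shear adds [l] times the [y]-sum, which must vanish
    modulo [p ^ a.+1]: hence [l = 0] or [a < b]. *)
Lemma unit_zero_sum_divx m a b x y (l : int) D : l = 0 \/ (a < b)%N ->
  (forall z, z \in D -> p %| x z - l * y z)%Z ->
  unit_zero_sum m a b (fun z => (x z - l * y z) %/ p)%Z y D ->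
  unit_zero_sum m a.+1 b x y D.
Proof.
move=> lab pD [T [c [TD Tm uc pa pb]]]; exists T, c; split=> //.
have -> : \sum_(z in T) c z * x z = l * (\sum_(z in T) c z * y z) +
    p%:Z * \sum_(z in T) c z * ((x z - l * y z) %/ p)%Z.
  rewrite !mulr_sumr -big_split /=; apply: eq_bigr => z zT.
  have := divzK (pD z (fintype.subsetP TD z zT)); set q := divz _ _ => Eq.
  by rewrite -[x z](subrK (l * y z)) -Eq; ring.
apply: rpredD; last by rewrite exprS dvdz_mul.
case: lab => [->|ab]; first by rewrite mul0r rpred0.
by rewrite dvdz_mull // (dvdz_trans _ pb) // dvdz_exp2l.
Qed.

Lemma unit_zero_sum_divy m a b x y D : (forall z, z \in D -> p %| y z)%Z ->
  unit_zero_sum m a b x (fun z => y z %/ p)%Z D ->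
  unit_zero_sum m a b.+1 x y D.
Proof.
move=> pD H; apply/unit_zero_sumC/(unit_zero_sum_divx (l := 0)) => [|z zD|].
- by left.
- by rewrite mul0r subr0 pD.
- have [T [c [TD Tm uc pa pb]]] := H; exists T, c; split=> //.
  by under eq_bigr do rewrite mul0r subr0.
Qed.

Lemma unit_zero_sum_div m a b x y D :
  (forall z, z \in D -> p %| x z)%Z -> (forall z, z \in D -> p %| y z)%Z ->
  unit_zero_sum m a b (fun z => x z %/ p)%Z (fun z => y z %/ p)%Z D ->
  unit_zero_sum m a.+1 b.+1 x y D.
Proof.
move=> px py H; apply: unit_zero_sum_divy => //.
by apply/unit_zero_sumC/unit_zero_sum_divy/unit_zero_sumC.
Qed.

Lemma unit_zero_sum_trivial m x y D : (m <= #|D|)%N -> unit_zero_sum m 0 0 x y D.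
Proof.
move=> mD; have [|T [_ TD Tm]] := @exists_subset_card _ finset.set0 D m 
    (finset.sub0set _).
  by rewrite cards0.
by exists T, (fun=> 1); split=> // z _; exact: not_dvdp1.
Qed.

(** Only [y] matters. Two values of [y] prime to [p] can be completed to any set of size [m];
    otherwise at most one vector is discarded, and dividing by [p] lowers [b] by one. *)
Lemma unit_zero_sum_rank1 m b x y D : (1 < m)%N -> (m + b <= #|D|)%N ->
  unit_zero_sum m 0 b x y D.
Proof.
move=> m1; elim: b y D => [|b IH] y D mD.
  by apply: unit_zero_sum_trivial; rewrite -(addn0 m).
set V := [set z in D | ~~ (p %| y z)%Z]%SET.
have VD : V \subset D by apply/fintype.subsetP => z; rewrite inE => /andP[].
have [V1|V1] := leqP #|V| 1.
  apply: (@unit_zero_sum_sub _ _ _ _ _ (D :\: V)); first exact: finset.subsetDl.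
  apply: unit_zero_sum_divy => [z|].
    by rewrite !inE => /andP[+ zD]; rewrite zD negbK.
  apply: IH; rewrite cardsD (finset.setIidPr VD); move: mD V1; lia.
have /card_gt1P[i [j [iV jV ij]]] := V1.
have [||T [/fintype.subsetP sT TD Tm]] := @exists_subset_card _ [set i; j]%SET D m.
- by apply/fintype.subsetP => z; rewrite !inE => /orP[]/eqP->; apply: (fintype.subsetP VD).
- by rewrite cards2 ij m1 (leq_trans _ mD) ?leq_addr.
move: iV jV; rewrite !inE => /andP[iD pi] /andP[jD pj].
have [||c uc Hc] := units_sum_rank1 b.+1 _ _ ij pi pj (T := T).
- by apply: sT; rewrite !inE eqxx.
- by apply: sT; rewrite !inE eqxx orbT.
by exists T, c; split=> //; exact: dvd1z.
Qed.


(** * Linear dependence modulo [p] *)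

Definition dep x y i j := (p %| det x y i j)%Z.

Lemma depC x y i j : dep x y i j = dep x y j i.
Proof. by rewrite /dep -rpredN /det opprB. Qed.

Lemma depii x y i : dep x y i i.
Proof. by rewrite /dep /det subrr rpred0. Qed.

(** A multiple of [det x y j k] by either coordinate of [i] is a combination of the two given
    determinants. A vector that is zero modulo [p] depends on every other, so [i] must be
    nonzero. *)
Lemma dep_trans x y i j k : ~~ ((p %| x i)%Z && (p %| y i)%Z) ->
  dep x y i j -> dep x y i k -> dep x y j k.
Proof.
rewrite /dep negb_and => /orP[] /negPf ni dj dk.
  have : (p %| x i * det x y j k)%Z.
    by apply: (dvdz_lincomb (- x k) (x j) dj dk); rewrite /det; ring.
  by rewrite dvdz_primeM ni.
have : (p %| y i * det x y j k)%Z.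
  by apply: (dvdz_lincomb (- y k) (y j) dj dk); rewrite /det; ring.
by rewrite dvdz_primeM ni.
Qed.

(** The ratio [X / Y], with [None] as the point at infinity, lies on the projective line over the
    field of [p] elements. Independent vectors have distinct ratios, and the line has [p.+1]
    points. *)
Lemma card_independent x y U : {in U &, forall i j, i != j -> ~~ dep x y i j} ->
  (#|U| <= p.+1)%N.
Proof.
move=> indep; pose X z : 'F_p := (x z)%:~R; pose Y z : 'F_p := (y z)%:~R.
pose f z := if Y z == 0 then None else Some (X z / Y z).
have <- : #|{: option 'F_p}| = p.+1 by rewrite card_option card_Fp.
apply: (@leq_card_in _ _ f) => i j iU jU fij; apply/eqP; apply: contraT => ij.
have := indep i j iU jU ij.
rewrite /dep (dvdz_pcharf (pchar_Fp p_prime)) /det rmorphB !rmorphM /= -!/(X _) -!/(Y _).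
move: fij; rewrite /f; case: eqVneq => [-> |Yi]; case: eqVneq => [-> |Yj] //.
  by rewrite !mulr0 subrr eqxx.
by move=> /(congr1 (odflt 0))/= /eqP; rewrite eqr_div // => /eqP ->; rewrite subrr eqxx.
Qed.

Lemma unit_zero_sum_from m a b x y D T : T \subset D -> #|T| = m ->
  (exists c, [/\ units_on T c, (p%:Z ^+ (a + b) %| \sum_(z in T) c z * x z)%Z &
    (p%:Z ^+ (a + b) %| \sum_(z in T) c z * y z)%Z]) ->
  unit_zero_sum m a b x y D.
Proof.
move=> TD Tm [c [uc cx cy]]; exists T, c; split=> //.
  by rewrite (dvdz_trans _ cx) // dvdz_exp2l ?leq_addr.
by rewrite (dvdz_trans _ cy) // dvdz_exp2l ?leq_addl.
Qed.

(** Cramer's rule is applied at [i] and [k]. The coefficient at [l] makes the determinant sum for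
    [i] a unit, then the one at [j] does so for [k]. The second choice preserves the first because
    [p] divides [det x y i j]. *)
Lemma units_sum_two_on_two_off T x y i j k l (N : nat) :
  i \in T -> j \in T -> k \in T -> l \in T -> i != j -> k != l ->
  ~~ ((p %| x i)%Z && (p %| y i)%Z) -> ~~ ((p %| x j)%Z && (p %| y j)%Z) ->
  dep x y i j -> ~~ dep x y i k -> ~~ dep x y i l ->
  exists c, [/\ units_on T c, (p%:Z ^+ N %| \sum_(z in T) c z * x z)%Z &
    (p%:Z ^+ N %| \sum_(z in T) c z * y z)%Z].
Proof.
move=> iT jT kT lT ij kl ni nj dij dik dil.
have neq z : ~~ dep x y i z -> (i != z) && (j != z).
  by move=> diz; rewrite !(contraNneq _ diz) // => <-; rewrite ?depii.
have /andP[ik jk] := neq _ dik; have /andP[il jl] := neq _ dil.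
have djk : ~~ dep x y j k.
  by apply: contra dik => djk; rewrite (dep_trans nj _ djk) // depC.
set S := T :\ i :\ k.
have lS : l \in S by rewrite !inE lT -(eq_sym k) kl eq_sym il.
have jS : j \in S by rewrite !inE jT jk eq_sym ij.
have [|v [uv Hv]] := @sum_avoid S l (det x y i) (fun=> 1) lS dil.
  by move=> *; exact: not_dvdp1.
set e := setv _ _ _ in uv Hv.
have [||w [uw Hw]] := @sum_avoid S j (det x y k) e jS.
- by have := djk; rewrite depC.
- by move=> z; rewrite inE => /andP[_ /uv].
apply: (units_sum_cramer N iT kT ik dik uw _ Hw).
rewrite sum_setv //; apply: contra Hv => Hv.
rewrite (big_setD1 j) //=; apply: (dvdz_lincomb 1 (e j - w) Hv dij); ring.
Qed.

(** Cramer's rule at [i] and [k] leaves two sums to keep prime to [p], and [l] contributes to both.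
    If [p > 4], its coefficient can be chosen for both at once; if all other vectors vanish modulo
    [p], only the term of [l] remains and coefficients 1 suffice. *)
Lemma units_sum_independent3 T x y i k l (N : nat) :
  (4 < p)%N \/ {in T :\ i :\ k :\ l, forall z, (p %| x z)%Z && (p %| y z)%Z} ->
  i \in T -> k \in T -> l \in T ->
  ~~ dep x y i k -> ~~ dep x y k l -> ~~ dep x y l i ->
  exists c, [/\ units_on T c, (p%:Z ^+ N %| \sum_(z in T) c z * x z)%Z &
    (p%:Z ^+ N %| \sum_(z in T) c z * y z)%Z].
Proof.
move=> H iT kT lT dik dkl; rewrite depC => dil.
have neq s t : ~~ dep x y s t -> s != t.
  by move=> dst; rewrite !(contraNneq _ dst) // => <-; rewrite depii.
have ik := neq _ _ dik.
have lS : l \in T :\ i :\ k by rewrite !inE lT !(eq_sym l) !neq.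
have u1 (S : {set I}) : units_on S (fun=> 1) by move=> z _; exact: not_dvdp1.
case: H => [p4|H].
  have [v [uv Hi Hk]] := sum_avoid2 p4 lS dil dkl (u1 _).
  exact: (units_sum_cramer N iT kT ik dik uv).
have Hd s : ~~ dep x y s l ->
    ~~ (p %| (\sum_(z in T :\ i :\ k) 1 * det x y s z)%R)%Z.
  apply: contra => Hs; rewrite (big_setD1 l) //= in Hs.
  have : (p %| \sum_(z in T :\ i :\ k :\ l) 1 * det x y s z)%Z.
    apply: rpred_sum => z /H /andP[px py]; rewrite mul1r /det.
    by apply: (dvdz_lincomb (x s) (- y s) py px); ring.
  by move=> Ho; apply: (dvdz_lincomb 1 (-1) Hs Ho); ring.
exact: (units_sum_cramer N iT kT ik dik (u1 _) (Hd _ dil) (Hd _ dkl)).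
Qed.

(** * The induction for [m >= 4] *)

Theorem unit_zero_sum_exists m a b x y D : (3 < m)%N -> (m + a + b <= #|D|)%N ->
  unit_zero_sum m a b x y D.
Proof.
move=> m3; move: {-1}(a + b)%N (leqnn (a + b)) => n.
elim: n => [|n IH] in a b x y D *.
  rewrite leqn0 addn_eq0 => /andP[/eqP-> /eqP->] mD.
  by apply: unit_zero_sum_trivial; rewrite !addn0 in mD.
(* The shear used below alters the first coordinate, which must be the one with the smaller
   exponent. *)
wlog ab : a b x y / (a <= b)%N => [th|].
  case: (leqP a b) => [|/ltnW] ab; first exact: th.
  move=> abn mD; apply/unit_zero_sumC/th => //; first by rewrite addnC.
  by rewrite addnAC.
case: a ab => [|a] ab abn mD.
  by apply: unit_zero_sum_rank1; rewrite ?(ltn_trans _ m3) // -(addn0 m).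
case: b ab abn mD => // b ab abn mD.
set U := [set z in D | ~~ ((p %| x z)%Z && (p %| y z)%Z)]%SET.
have UD : U \subset D by apply/fintype.subsetP => z; rewrite inE => /andP[].
have nU z : z \in U -> ~~ ((p %| x z)%Z && (p %| y z)%Z) by rewrite inE => /andP[].
have DU z : z \in D :\: U -> (p %| x z)%Z && (p %| y z)%Z.
  by rewrite !inE => /andP[+ zD]; rewrite zD negbK.
(* Discarding two vectors is paid for by both exponents dropping by one. *)
have [U2|U2] := leqP #|U| 2.
  apply: (@unit_zero_sum_sub _ _ _ _ _ (D :\: U)); first exact: finset.subsetDl.
  apply: unit_zero_sum_div => [z /DU/andP[]|z /DU/andP[]|] //.
  apply: IH; first lia.
  rewrite cardsD (finset.setIidPr UD); lia.
have [/existsP[i /existsP[j /and4P[iU jU ij dij]]]|indep] :=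
    boolP [exists i, [exists j, [&& i \in U, j \in U, i != j & dep x y i j]]].
  set K := [set z in D | ~~ dep x y i z]%SET.
  have KD : K \subset D by apply/fintype.subsetP => z; rewrite inE => /andP[].
  have [K1|K1] := leqP #|K| 1.
    apply: (@unit_zero_sum_sub _ _ _ _ _ (D :\: K)); first exact: finset.subsetDl.
    have cDK : (m + a.+1 + b.+1 <= #|D :\: K|.+1)%N.
      by rewrite cardsD (finset.setIidPr KD); move: mD K1; clear; lia.
    have DK z : z \in D :\: K -> dep x y i z.
      by rewrite !inE => /andP[+ zD]; rewrite zD negbK.
    (* The line of [i] is either [y = 0] modulo [p], or [x = l * y] with [l] the quotient of [x i]
       by [y i]. *)
    have [py|py] := boolP (p %| y i)%Z.
      have px : (p %| x i)%Z = false by apply: negbTE; have := nU i iU; rewrite py andbT.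
      apply: unit_zero_sum_divy => [z /DK dz|].
        have : (p %| x i * y z)%Z.
          by apply: (dvdz_lincomb 1 (x z) dz py); rewrite /det; ring.
        by rewrite dvdz_primeM px.
      by apply: IH; move: abn cDK; clear; lia.
    have [e pe He] := inverse_mod_exp 1 py.
    apply: (unit_zero_sum_divx (l := e * x i)) => [|z /DK dz|].
    - by right.
    - apply: (dvdz_lincomb (- e) (- x z) dz He); rewrite /det; ring.
    - by apply: IH; move: abn cDK; clear; lia.
  have /card_gt1P[k [l [kK lK kl]]] := K1.
  move: kK lK; rewrite !inE => /andP[kD dik] /andP[lD dil].
  pose Q := [set i; j; k; l]%SET.
  (* The four vectors fit into a set of size [m] because [3 < m]. *)
  have [||T [/fintype.subsetP QT TD Tm]] := @exists_subset_card _ Q D m.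
  - by apply/fintype.subsetP => z; rewrite !inE => /orP[/orP[/orP[]|]|] /eqP-> //;
      apply: (fintype.subsetP UD).
  - rewrite (leq_trans _ m3) /=; last first.
      by rewrite /Q -!finset.setUA !cardsU1 cards1;
      move: (_ \in _) (_ \in _) (_ \in _) => [] [] [].
    by move: mD; clear; lia.
  apply: (unit_zero_sum_from TD Tm).
  by apply: (units_sum_two_on_two_off _ (i := i) (j := j) (k := k) (l := l)) => //;
    rewrite ?QT ?inE ?eqxx ?orbT ?nU.
have indepU : {in U &, forall i j, i != j -> ~~ dep x y i j}.
  move=> i j iU jU ij; apply: contra indep => dij.
  by apply/existsP; exists i; apply/existsP; exists j; apply/and4P.
have /card_gt2P[i [k [l [[iU kU lU] [ik kl li]]]]] := U2.
pose Q := [set i; k; l]%SET.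
have QD : Q \subset D.
  by apply/fintype.subsetP => z; rewrite !inE => /orP[/orP[]|] /eqP->;
    apply: (fintype.subsetP UD).
have cQ : #|Q| = 3%N.
  by rewrite /Q -finset.setUA !cardsU1 cards1 !inE negb_or ik kl eq_sym li.
have HT T : Q \subset T -> T \subset D -> #|T| = m ->
    (4 < p)%N \/ {in T :\ i :\ k :\ l, forall z, (p %| x z)%Z && (p %| y z)%Z} ->
    unit_zero_sum m a.+1 b.+1 x y D.
  move=> /fintype.subsetP QT TD Tm H; apply: (unit_zero_sum_from TD Tm).
  have [iT kT lT] : [/\ i \in T, k \in T & l \in T].
    by split; apply: QT; rewrite !inE eqxx ?orbT.
  by apply: (units_sum_independent3 _ H); rewrite ?indepU.
(* Three independent vectors can be completed arbitrarily when [4 < p]; when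
   [p = 3] there are at most four vectors in [U], so [D :\: U] has enough. *)
have [p4|p4] := ltnP 4 p.
  have [||T [QT TD Tm]] := @exists_subset_card _ Q D m => //.
    by rewrite cQ; move: m3 mD; clear; lia.
  by apply: (HT T) => //; left.
have [||T [QT TD Tm]] := @exists_subset_card _ Q (Q :|: (D :\: U)) m.
- exact: finset.subsetUl.
- rewrite cQ (ltnW m3) cardsU cQ; set X := #|Q :&: _|.
  have X0 : X = 0%N.
    apply/eqP; rewrite cards_eq0 -finset.subset0; apply/fintype.subsetP => z.
    rewrite finset.in_setI => /andP[zQ /DU]; apply: contraTT => _.
    by move: zQ; rewrite !inE => /orP[/orP[]|] /eqP->; apply: nU.
  rewrite X0 cardsD (finset.setIidPr UD).
  have := card_independent indepU; move: mD p4 p_odd (prime_gt1 p_prime); clear.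
  case: p => [|[|[|[|[|]]]]] //; lia.
apply: (HT T) => //.
  by apply: (fintype.subset_trans TD); rewrite finset.subUset QD finset.subsetDl.
right=> z; rewrite !inE => /and4P[zl zk zi /(fintype.subsetP TD)].
by rewrite !(finset.in_setU, finset.in_set1) (negPf zl) (negPf zk) (negPf zi) => /DU.
Qed.


(** * The case [m = 3] with both exponents one *)

(** On a line modulo [p] it suffices to annihilate the [x]-sum: [x i] times the [y]-sum is [y i]
    times the [x]-sum plus a sum of determinants divisible by [p]. *)
Lemma units_sum_line T x y i j : i \in T -> j \in T -> i != j ->
  ~~ (p %| x i)%Z -> ~~ ((p %| x j)%Z && (p %| y j)%Z) ->
  {in T, forall z, dep x y i z} ->
  exists c, [/\ units_on T c, (p %| \sum_(z in T) c z * x z)%Z &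
    (p %| \sum_(z in T) c z * y z)%Z].
Proof.
move=> iT jT ij pi nj line.
have pj : ~~ (p %| x j)%Z.
  apply: contra nj => pj; rewrite pj /=.
  have : (p %| x i * y j)%Z.
    by apply: (dvdz_lincomb 1 (y i) (line j jT) pj); rewrite /det; ring.
  by rewrite dvdz_primeM (negPf pi).
have [c uc cx] := units_sum_rank1 1 iT jT ij pi pj.
exists c; split=> //.
have cd : (p %| \sum_(z in T) c z * det x y i z)%Z.
  by apply: rpred_sum => z zT; rewrite dvdz_mull //; apply: line.
have : (p %| x i * \sum_(z in T) c z * y z)%Z.
  apply: (dvdz_lincomb 1 (y i) cd cx); rewrite !mulr_sumr -big_split /=.
  by apply: eq_bigr => z _; rewrite /det; ring.
by rewrite dvdz_primeM (negPf pi).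
Qed.

(* In [unit_zero_sum_exists] the pattern "two vectors on a line, two off it"
   needs [3 < m]; for [m = 3] only the elementary abelian case is needed. *)
Lemma unit_zero_sum_three x y D : (4 < #|D|)%N -> unit_zero_sum 3 1 1 x y D.
Proof.
move=> D4.
set U := [set z in D | ~~ ((p %| x z)%Z && (p %| y z)%Z)]%SET.
have UD : U \subset D by apply/fintype.subsetP => z; rewrite inE => /andP[].
have nU z : z \in U -> ~~ ((p %| x z)%Z && (p %| y z)%Z) by rewrite inE => /andP[].
have DU z : z \in D :\: U -> (p %| x z)%Z && (p %| y z)%Z.
  by rewrite !inE => /andP[+ zD]; rewrite zD negbK.
have [U2|U2] := leqP #|U| 2.
  apply: (@unit_zero_sum_sub _ _ _ _ _ (D :\: U)); first exact: finset.subsetDl.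
  apply: unit_zero_sum_div => [z /DU/andP[]|z /DU/andP[]|] //.
  apply: unit_zero_sum_trivial.
  rewrite cardsD (finset.setIidPr UD); lia.
have triple i k l : i \in U -> k \in U -> l \in U ->
    ~~ dep x y i k -> ~~ dep x y k l -> ~~ dep x y l i -> unit_zero_sum 3 1 1 x y D.
  move=> iU kU lU dik dkl dli.
  have neq s t : ~~ dep x y s t -> s != t.
    by move=> dst; rewrite !(contraNneq _ dst) // => <-; rewrite depii.
  apply: (@unit_zero_sum_from _ _ _ _ _ _ [set i; k; l]%SET).
  - by apply/fintype.subsetP => z; rewrite !inE => /orP[/orP[]|] /eqP->;
      apply: (fintype.subsetP UD).
  - by rewrite -finset.setUA !cardsU1 cards1 !inE negb_or (eq_sym i l) !neq.
  - apply: (@units_sum_independent3 _ _ _ i k l) => //; rewrite ?inE ?eqxx ?orbT //.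
    by right=> z; rewrite !inE; do !case: eqP.
pose H i := [set z in D | dep x y i z]%SET.
have HD i : H i \subset D by apply/fintype.subsetP => z; rewrite inE => /andP[].
have line i j : i \in U -> j \in U -> i != j -> dep x y i j -> (2 < #|H i|)%N ->
    unit_zero_sum 3 1 1 x y D.
  move=> iU jU ij dij H2.
  have [||T [/fintype.subsetP sT TH T3]] := @exists_subset_card _ [set i; j]%SET (H i) 3.
  - by apply/fintype.subsetP => z; rewrite !inE => /orP[]/eqP->;
      rewrite ?depii ?dij (fintype.subsetP UD).
  - by rewrite cards2 ij.
  have iT : i \in T by apply: sT; rewrite !inE eqxx.
  have jT : j \in T by apply: sT; rewrite !inE eqxx orbT.
  have dT : {in T, forall z, dep x y i z}.
    by move=> z /(fintype.subsetP TH); rewrite inE => /andP[].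
  have TD := fintype.subset_trans TH (HD i).
  have [px|px] := boolP (p %| x i)%Z; last first.
    have [c [uc cx cy]] := units_sum_line iT jT ij px (nU j jU) dT.
    by exists T, c.
  have py : ~~ (p %| y i)%Z by have := nU i iU; rewrite px.
  have [||c [uc cx cy]] := @units_sum_line T y x i j iT jT ij py.
  - by rewrite andbC nU.
  - move=> z /dT; rewrite /dep -rpredN /det opprB => h.
    by apply: (dvdz_scale 1 h); ring.
  - by exists T, c.
have [/existsP[i /existsP[j /and4P[iU jU ij dij]]]|indep] :=
    boolP [exists i, [exists j, [&& i \in U, j \in U, i != j & dep x y i j]]].
  (* If only two vectors lie on the line of [i], at least three nonzero ones lie off it. Either two
     of these are independent and form a triple with [i], or all three share a line. *)
  have [Hi|] := leqP #|H i| 2; last exact: line dij.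
  have /card_gt2P[k [l [q [[kK lK qK] [kl lq qk]]]]] : (2 < #|D :\: H i|)%N.
    by rewrite cardsD (finset.setIidPr (HD i)); move: D4 Hi; clear; lia.
  have inK z : z \in D :\: H i -> (z \in D) && ~~ dep x y i z.
    by rewrite !inE andbC; case: (z \in D).
  have KU z : z \in D :\: H i -> z \in U.
    move=> /inK/andP[zD diz]; rewrite inE zD; apply: contra diz => /andP[px py].
    by apply: (dvdz_lincomb (x i) (- y i) py px); rewrite /det; ring.
  have [/andP[kD dik] /andP[lD dil] /andP[qD diq]] :=
    And3 (inK _ kK) (inK _ lK) (inK _ qK).
  have [dkl|dkl] := boolP (dep x y k l); last first.
    by apply: (triple i k l) => //; [exact: KU|exact: KU|rewrite depC].
  have [dkq|dkq] := boolP (dep x y k q); last first.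
    by apply: (triple i k q) => //; [exact: KU|exact: KU|rewrite depC].
  apply: (line k l); rewrite ?KU //.
  apply/card_gt2P; exists k, l, q; split=> //.
  by split; rewrite inE ?kD ?lD ?qD ?depii.
have /card_gt2P[i [k [l [[iU kU lU] [ik kl li]]]]] := U2.
have indepU s t : s \in U -> t \in U -> s != t -> ~~ dep x y s t.
  move=> sU tU st; apply: contra indep => dst.
  by apply/existsP; exists s; apply/existsP; exists t; apply/and4P.
by apply: (triple i k l); rewrite ?indepU.
Qed.

End WeightedSums.

(** * From integers to residues and admissible weights *)

Lemma intr_Zp_eq0 (q : nat) (z : int) : (1 < q)%N ->
  (z%:~R == 0 :> 'Z_q) = (q %| z)%Z.
Proof.
move=> q1.
have nat_case n : (n%:R == 0 :> 'Z_q) = (q %| n)%N.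
  by rewrite -val_eqE /= val_Zp_nat.
by case: z => n; rewrite ?NegzE ?mulrNz ?oppr_eq0 nat_case dvdzE.
Qed.

Lemma Posz_exp (a : nat) : ((p ^ a)%N : int) = p%:Z ^+ a.
Proof. by rewrite -[LHS]natz natrX natz. Qed.

Lemma expp_gt1 (a : nat) : (0 < a)%N -> (1 < p ^ a)%N.
Proof. by move=> a0; rewrite -{1}(exp1n a) ltn_exp2r // prime_gt1. Qed.

Lemma sum_pair_mulrz (U V : zmodType) (J : Type) (r : seq J) (v : J -> U * V)
    (c : J -> int) :
  \sum_(i <- r) v i *~ c i =
    (\sum_(i <- r) (v i).1 *~ c i, \sum_(i <- r) (v i).2 *~ c i).
Proof.
elim: r => [|i r IH]; first by rewrite !big_nil.
rewrite !big_cons {}IH; case: (v i) (c i) => v1 v2 [] n.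
  by rewrite -!pmulrn pairMnE.
by rewrite NegzE !mulrNz -!pmulrn pairMnE.
Qed.


Definition prime_to_p (n : nat) : set int :=
  ([set Posz a | a in [set a : nat | 1 <= a <= n /\ gcdn a p = 1%N]])%N.

Lemma prime_to_pP n a : (0 < n)%N -> prime_to_p (p ^ n)%N a -> ~~ (p %| a)%Z.
Proof.
move=> n0 [b [_ gb] <-]; rewrite dvdzE /=.
by rewrite -prime_coprime // coprime_sym /coprime gb.
Qed.

(** Reduction modulo [p ^ n] preserves being prime to [p], so the remainder is also nonzero and
    falls in the required range. *)
Lemma prime_to_p_modz n (c : int) : (0 < n)%N -> ~~ (p %| c)%Z ->
  prime_to_p (p ^ n)%N (c %% (p ^ n)%N)%Z.
Proof.
move=> n0 pc; set q := (p ^ n)%N.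
have q0 : q%:Z != 0 by rewrite /q -lt0n expn_gt0 prime_gt0.
have pr : ~~ (p %| (c %% q)%Z)%Z.
  apply: contra pc => pr; rewrite (divz_eq c q) rpredD // dvdz_mull //.
  by rewrite dvdzE /= /q dvdn_exp.
have r0 := modz_ge0 c q0; have rq := ltz_mod c q0.
move: pr r0 rq; case: (c %% q)%Z => // r pr _ rq.
exists r => //; split; last first.
  by apply/eqP; rewrite -/(coprime r p) coprime_sym prime_coprime.
apply/andP; split; last by apply: ltnW; move: rq; rewrite ltz_nat.
by rewrite lt0n; apply: contraNneq pr => ->; rewrite dvdz0.
Qed.

End ResiduesModP.

(** * Comparison of the two constants *)

Section Transfer.

Set Implicit Arguments.
Unset Strict Implicit.

Local Open Scope ring_scope.

(** Indexing the weights by [nat] frees them from a type that depends on [t], so that [t] can be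
    split or reindexed. *)
Lemma weighted_zero_sum_nat (A : set int) (G : finZmodType) (t : seq G) :
  weighted_zero_sum A t <-> (0 < size t)%N /\ exists U : nat -> int,
    (forall i, (i < size t)%N -> A (U i)) /\ \sum_(0 <= i < size t) t`_i *~ U i = 0.
Proof.
split=> [[t0 [u [Au u0]]]|[t0 [U [AU U0]]]]; split=> //; last first.
  by exists (fun i => U i); split=> [i|]; [exact: AU|rewrite big_mkord in U0].
case: t t0 u Au u0 => // x t _ u Au u0; exists (fun k => u (inord k)).
split=> [i _|]; first exact: Au.
by rewrite big_mkord -[RHS]u0; apply: eq_bigr => i _; rewrite inord_val.
Qed.

(** A selection of [gexp G] terms from [s] followed by [(gexp G).-1] zeros uses some term of [s];
    removing the zeros does not change its sum. *)
Lemma eta_forces_of_s_forces (A : set int) (G : finZmodType) (l : nat) :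
  s_forces A G l -> eta_forces A G (l.+1 - gexp G).
Proof.
move=> sl s les; set z := nseq (gexp G).-1 (0 : G).
have [|t [/subseqP[m szm tm] /weighted_zero_sum_nat[t0 [U [AU U0]]] szt]] :=
    sl (s ++ z).
  by rewrite size_cat size_nseq; have := gexp_gt0 G; lia.
move: szm tm; rewrite size_cat => szm.
have ltm : (size s <= size m)%N by rewrite szm leq_addr.
rewrite -(cat_take_drop (size s) m) mask_cat ?size_takel //.
set t1 := mask _ s; set t2 := mask _ z => Et.
have t1s : subseq t1 s by exact: mask_subseq.
have t2z y : y \in t2 -> y = 0 by move/mem_mask; rewrite mem_nseq => /andP[_ /eqP].
have szt2 : (size t2 < gexp G)%N.
  have /size_subseq := mask_subseq (drop (size s) m) z.
  by rewrite -/t2 [size z]size_nseq => le2; rewrite -(prednK (gexp_gt0 G)) ltnS.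
have szt1 : (0 < size t1)%N by move: szt szt2; rewrite Et size_cat; lia.
exists t1; split=> //; last by rewrite -szt Et size_cat leq_addr.
apply/weighted_zero_sum_nat; split=> //; exists U; split=> [i it1|].
  by apply: AU; rewrite Et size_cat ltn_addr.
have tail0 : \sum_(size t1 <= i < size t1 + size t2) t`_i *~ U i = 0.
  rewrite big_nat_cond big1 // => i; rewrite andbT => /andP[i1 i2].
  by rewrite Et nth_cat ltnNge i1 /= [t2`_ _]t2z ?mul0rz // mem_nth // ltn_subLR.
have szt12 : size t = (size t1 + size t2)%N by rewrite Et size_cat.
rewrite szt12 (big_cat_nat (leq0n _) (leq_addr _ _)) tail0 [LHS]addr0 in U0.
rewrite -[RHS]U0; apply: eq_big_nat => i /andP[_ it1].
by rewrite Et nth_cat it1.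
Qed.

(** Positivity of [eta_const A G] guards against truncation when [gexp G] is moved across the
    inequality. *)
Lemma s_const_ge (A : set int) (G : finZmodType) : A !=set0 ->
  (0 < eta_const A G)%N -> (eta_const A G + gexp G - 1 <= s_const A G)%N.
Proof.
move=> A0; have [sf _] := s_constP G A0.
have [_ /(_ _ (eta_forces_of_s_forces sf))] :=
  eta_constP G A0.
have := gexp_gt0 G; lia.
Qed.

(** * Bounds for the group of rank two *)

Variables (p alpha beta : nat).
Hypotheses (p_prime : prime p) (p_odd : odd p) (a0 : (0 < alpha)%N) (b0 : (0 < beta)%N).

Let n := maxn alpha beta.
Let G : finZmodType := ('Z_(p ^ alpha) * 'Z_(p ^ beta))%type.
Let A := prime_to_p p (p ^ n).

Lemma n_gt0 : (0 < n)%N.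
Proof. by rewrite leq_max a0. Qed.

Lemma s_forces_prod_Zp : s_forces A G (p ^ n + alpha + beta).
Proof.
move=> s les.
(* The index set consists of positions in [s], so equal terms count separately; coordinates are
   lifted to integers. *)
pose x (i : 'I_(size s)) : int := (s`_i).1 : nat.
pose y (i : 'I_(size s)) : int := (s`_i).2 : nat.
have [T [c [_ Tn uc cx cy]]] : unit_zero_sum p (p ^ n) alpha beta x y [set: 'I_(size s)]%SET.
  have cs : (p ^ n + alpha + beta <= #|[set: 'I_(size s)]%SET|)%N by rewrite cardsT card_ord.
  have p3 : (2 < p)%N by apply: odd_prime_gt2.
  have [n1|n1] := ltnP 1 n.
    apply: unit_zero_sum_exists => //.
    by rewrite (@leq_trans (3 ^ 2)) // (@leq_trans (p ^ 2)) ?leq_exp2r ?leq_exp2l // ltnW.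
  have En : n = 1%N by apply/eqP; rewrite eqn_leq n1 n_gt0.
  have [Ea Eb] : alpha = 1%N /\ beta = 1%N.
    by move: n1; rewrite geq_max => /andP[a1 b1]; split; apply/eqP; rewrite eqn_leq ?a1 ?b1.
  rewrite En expn1 {}Ea {}Eb in cs *.
  have [p4|p4] := ltnP 3 p; first exact: unit_zero_sum_exists.
  have Ep : p = 3%N by apply/eqP; rewrite eqn_leq p4.
  by rewrite [X in unit_zero_sum p X]Ep; apply: unit_zero_sum_three => //; apply: leq_trans cs; lia.
exists [seq s`_(val i) | i <- enum T]; split.
- rewrite -[X in subseq _ X](mkseq_nth 0 s) /mkseq -val_enum_ord -map_comp.
  apply: map_subseq; rewrite [enum 'I_(size s)]enumT; exact: filter_subseq.
- have szT : (0 < #|T|)%N by rewrite Tn expn_gt0 prime_gt0.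
  have /card_gt0P[i0 _] := szT.
  apply/weighted_zero_sum_nat; rewrite size_map -cardE; split=> //.
  (* Reducing the coefficients modulo the exponent of [G] brings them into [A] without changing any
     multiple of an element. *)
  exists (fun k => (c (nth i0 (enum T) k) %% (p ^ n)%N)%Z); split=> [k kT|].
    by apply: prime_to_p_modz n_gt0 _ => //; apply: uc; rewrite -mem_enum mem_nth -?cardE.
  have gG : gexp G = (p ^ n)%N by exact: gexp_prod_Zp.
  transitivity (\sum_(i <- enum T) s`_(val i) *~ c i).
    rewrite (big_nth i0) -cardE; apply: eq_big_nat => k /andP[_ kT].
    rewrite (nth_map i0) -?cardE //; set i := nth i0 _ _; set v := nth _ s _.
    have v0 : v *~ ((c i %/ (p ^ n)%N)%Z * (p ^ n)%N) = 0.
      by rewrite mulrC mulrzA -pmulrn -gG mulrn_gexp mul0rz.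
    by rewrite [in RHS](divz_eq (c i) (p ^ n)%N) [RHS]mulrzDr v0 add0r.
  have comp q (w : 'I_(size s) -> 'Z_q) : (1 < q)%N ->
      (q %| \sum_(i in T) c i * (w i : nat))%Z -> \sum_(i <- enum T) w i *~ c i = 0.
    move=> q1; rewrite -intr_Zp_eq0 // rmorph_sum /= => /eqP S0; rewrite -[RHS]S0 big_enum /=.
    apply: eq_bigr => i _; rewrite rmorphM /= mulrC.
    by rewrite -[in LHS](natr_Zp (w i)) mulrzr.
  rewrite sum_pair_mulrz !comp ?expp_gt1 //.
  + by rewrite Posz_exp.
  + by rewrite Posz_exp.
- by rewrite size_map -cardE Tn; symmetry; apply: gexp_prod_Zp.
Qed.

(** The witness lists the elements [(p ^ j, 0)] and then [(0, p ^ j)]. In any subsequence the first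
    term has, in its nonzero coordinate, a strictly smaller power of [p] than all later nonzero
    entries, so a unit multiple of it cannot be cancelled. *)
Lemma eta_forces_gt l : eta_forces A G l -> (alpha + beta < l)%N.
Proof.
move=> el; rewrite ltnNge; apply/negP => lab.
pose h1 j : int := if (j < alpha)%N then p%:Z ^+ j else 0.
pose h2 j : int := if (j < alpha)%N then 0 else p%:Z ^+ (j - alpha).
pose g j : G := ((h1 j)%:~R, (h2 j)%:~R).
have [|t [/subseqP[m _ tm] [t0 [u [Au u0]]] _]] :=
    el [seq g j | j <- iota 0 (alpha + beta)].
  by rewrite size_map size_iota.
rewrite -map_mask in tm.
have js_sorted : sorted ltn (mask m (iota 0 (alpha + beta))).
  by apply: (sorted_mask ltn_trans); exact: iota_ltn_sorted.
have js_lt j : j \in mask m (iota 0 (alpha + beta)) -> (j < alpha + beta)%N.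
  by move/mem_mask; rewrite mem_iota.
move: js_sorted js_lt tm; case: (mask _ _) => [_ _ tm|k js]; first by rewrite tm in t0.
move=> /(order_path_min ltn_trans)/allP kjs js_lt tm; subst t.
have klt := js_lt k (mem_head _ _).
have no e N (h : nat -> int) : (e < N)%N -> h k = p%:Z ^+ e ->
    (forall j, (k < j)%N -> (p%:Z ^+ e.+1 %| h j)%Z) ->
    \sum_(i < (size [seq g j | j <- js]).+1)
      ((h (nth 0%N (k :: js) i))%:~R : 'Z_(p ^ N)) *~ u i != 0.
  move=> eN hk hj; rewrite (eq_bigr (fun i : 'I_(size [seq g j | j <- js]).+1 =>
    (h (nth 0%N (k :: js) i) * u i)%:~R)); last first.
    by move=> i _; rewrite intrM mulrzr.
  rewrite -rmorph_sum /= intr_Zp_eq0 ?expp_gt1 ?(leq_trans _ eN) //.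
  rewrite big_ord_recl /= hk Posz_exp; apply/negP => pN.
  have pe : (p%:Z ^+ e.+1 %| p%:Z ^+ N)%Z by exact: dvdz_exp2l.
  have : (p%:Z ^+ e.+1 %| p%:Z ^+ e * u ord0)%Z.
    have rest : (p%:Z ^+ e.+1 %| \sum_(i < size [seq g j | j <- js])
        h (nth 0%N js (0 + i)) * u (lift ord0 i))%Z.
      apply: rpred_sum => i _; rewrite dvdz_mulr // hj //; apply: kjs.
      by rewrite mem_nth // -(size_map g); exact: ltn_ord.
    by apply: (dvdz_lincomb 1 (-1) (dvdz_trans pe pN) rest); ring.
  rewrite exprSr dvdz_mul2l ?expf_neq0 -?lt0n ?prime_gt0 //.
  by apply/negP/prime_to_pP; [|exact: n_gt0|exact: Au].
have Eg (i : 'I_(size [seq g j | j <- js]).+1) :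
  [seq g j | j <- k :: js]`_i = g (nth 0%N (k :: js) i).
  by rewrite (nth_map 0%N) //= -(size_map g); exact: ltn_ord.
rewrite (eq_bigr (fun i : 'I_(size [seq g j | j <- js]).+1 =>
  g (nth 0%N (k :: js) i) *~ u i)) in u0; last by move=> i _; rewrite Eg.
rewrite sum_pair_mulrz in u0; case: (ltnP k alpha) => ka.
  have h1k : h1 k = p%:Z ^+ k by rewrite /h1 ka.
  apply: (elimN eqP (no k alpha h1 ka h1k _) (congr1 fst u0)) => j kj.
  by rewrite /h1; case: ifP => _; rewrite ?dvdz0 ?dvdz_exp2l.
have kb : (k - alpha < beta)%N by rewrite ltn_subLR.
have h2k : h2 k = p%:Z ^+ (k - alpha) by rewrite /h2 ltnNge ka.
apply: (elimN eqP (no _ beta h2 kb h2k _) (congr1 snd u0)) => j kj.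
rewrite /h2 ltnNge (leq_trans ka (ltnW kj)) /=.
by rewrite dvdz_exp2l // ltn_sub2r // (leq_ltn_trans ka kj).
Qed.

End Transfer.

Theorem corollary6p2 (p alpha beta : nat) :
  prime p -> odd p -> 0 < alpha -> 0 < beta ->
  let G : finZmodType := ('Z_(p ^ alpha) * 'Z_(p ^ beta))%type in
  let A : set int :=
    [set Posz a | a in
      [set a : nat | 1 <= a <= p ^ maxn alpha beta /\ gcdn a p = 1]] in
  s_const A G = eta_const A G + gexp G - 1.
Proof.
move=> pp po a0 b0 G A.
have A0 : A !=set0.
  exists 1%Z; exists 1 => //; split; last exact: gcd1n.
  by rewrite /= expn_gt0 prime_gt0.
have [eta_f _] := eta_constP G A0; have [_ s_min] := s_constP G A0.
have eta_lb := eta_forces_gt pp a0 eta_f.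
apply/eqP; rewrite eqn_leq s_const_ge ?(leq_ltn_trans _ eta_lb) // andbT.
have gG : gexp G = p ^ maxn alpha beta by exact: gexp_prod_Zp.
(* Since [alpha + beta + 1] is at most [eta_const A G], the bound [gexp G + alpha + beta] is already
   small enough. *)
apply: leq_trans (s_min _ (s_forces_prod_Zp pp po a0 b0)) _.
by rewrite gG; move: eta_lb; rewrite -/A -/G; lia.
Qed.
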